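(* Let $L \geq 1$ and $N \geq 0$ be integers, and let $\lambda_0, \lambda$ be real constants. Define $\mathcal{H}^{\lambda,\lambda_0,L,N} \subset \mathbb{R}^{L(2N+2)+1} = \mathbb{C}^{(N+1)L} \times \mathbb{R}$ by \[ \mathcal{H}^{\lambda,\lambda_0,L,N} = \left\{ \begin{bmatrix} e^{i(\lambda\Theta)} Z \\ \lambda_0 \Theta \end{bmatrix} : \Theta \in \mathbb{R},\ Z \in \mathcal{C}_L\!\left(\tfrac{1}{\sqrt{2}}\mathbb{S}^N \times \tfrac{1}{\sqrt{2}}\mathbb{S}^N\right) \right\}. \] Explicitly, \[ \mathcal{H}^{\lambda,\lambda_0,L,N} = \left\{ \begin{bmatrix} r_1 e^{i(\lambda\Theta)}(X + iY) \\ \vdots \\ r_L e^{i(\lambda\Theta)}(X + iY) \\ \lambda_0\Theta \end{bmatrix} : \Theta, r_1, \dots, r_L \in \mathbb{R},\ \begin{bmatrix} X \\ Y \end{bmatrix} \in \tfrac{1}{\sqrt{2}}\mathbb{S}^N \times \tfrac{1}{\sqrt{2}}\mathbb{S}^N \right\}. \] Then $\mathcal{H}^{\lambda,\lambda_0,L,N}$ is minimal in $\mathbb{R}^{L(2N+2)+1}$. Moreover, it is invariant under the multi-screw motion $\mathcal{S}_\Lambda$ with $\Lambda = (\lambda_0, \lambda, \dots, \lambda)$, that is, $\lambda_1 = \dots = \lambda_L = \lambda$.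
   Context: The Clifford torus $\frac{1}{\sqrt{2}}\mathbb{S}^N \times \frac{1}{\sqrt{2}}\mathbb{S}^N$ is the set \[ \left\{ \tfrac{1}{\sqrt{2}}\begin{bmatrix} X \\ Y \end{bmatrix} \in \mathbb{R}^{2N+2} : \|X\| = \|Y\| = 1 \right\} \subset \mathbb{S}^{2N+1}. \] Points of $\mathbb{R}^{2N+2}$ are identified with $X + iY \in \mathbb{C}^{N+1}$, and $e^{i\alpha}$ acts componentwise. The $L$-rays Clifford cone is \[ \mathcal{C}_L\!\left(\tfrac{1}{\sqrt{2}}\mathbb{S}^N \times \tfrac{1}{\sqrt{2}}\mathbb{S}^N\right) = \left\{ \left(r_1(X + iY), \dots, r_L(X + iY)\right) : r_1, \dots, r_L \in \mathbb{R},\ \|X\| = \|Y\| = 1 \right\} \subset \mathbb{C}^{(N+1)L}. \] For $\Lambda = (\lambda_0, \lambda_1, \dots, \lambda_L)$, the multi-screw motion $\mathcal{S}_\Lambda$ (with parameter $\theta \in \mathbb{R}$) is the map \[ (X_1 + iY_1, \dots, X_L + iY_L, z) \mapsto \left(e^{i(\lambda_1\theta)}(X_1 + iY_1), \dots, e^{i(\lambda_L\theta)}(X_L + iY_L),\ z + \lambda_0\theta\right). \] *)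

(* Defs.v *)
From HB Require Import structures.
From mathcomp Require Import all_boot all_order all_algebra.
From mathcomp Require Import all_classical all_reals all_analysis.
Set Implicit Arguments. Unset Strict Implicit. Unset Printing Implicit Defensive.
Import Order.TTheory GRing.Theory Num.Theory.
Import numFieldNormedType.Exports.
Local Open Scope classical_set_scope.
Local Open Scope ring_scope.

(* Ambient dimension L(2N+2)+1. Coordinate k < L(2N+2) is decoded as
   l = k / (2N+2) (block index, 0-based), m = k mod (2N+2);
   m < N+1 : real part of component m of block l,
   otherwise imaginary part of component m-(N+1) of block l.
   The last coordinate is the R-factor. *)
Notation dimH L N := ((L * (2 * N + 2)).+1)%N.

Section Defs.
Variable R : realType.

Definition Hpoint (L N : nat) (lam lam0 Th : R) (r X Y : nat -> R)
  : 'rV[R]_(dimH L N) :=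
  \row_(k < dimH L N)
    if (k < L * (2 * N + 2))%N then
      let l := (k %/ (2 * N + 2))%N in
      let m := (k %% (2 * N + 2))%N in
      if (m < N.+1)%N then
        r l * (cos (lam * Th) * X m - sin (lam * Th) * Y m)
      else
        r l * (sin (lam * Th) * X (m - N.+1)%N + cos (lam * Th) * Y (m - N.+1)%N)
    else lam0 * Th.

Definition unit_vec (N : nat) (X : nat -> R) : Prop :=
  \sum_(j < N.+1) X j ^+ 2 = 1.

Definition Hset (L N : nat) (lam lam0 : R) : set 'rV[R]_(dimH L N) :=
  [set p | exists (Th : R) (r X Y : nat -> R),
      unit_vec N X /\ unit_vec N Y /\ p = Hpoint L N lam lam0 Th r X Y].

(* Multi-screw motion S_Lambda with parameter th, Lambda = (lam0, lams 0, ..., lams (L-1)):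
   block l is multiplied by e^{i lams_l th}, last coordinate shifted by lam0 th. *)
Definition screw (L N : nat) (lams : nat -> R) (lam0 th : R)
  (p : 'rV[R]_(dimH L N)) : 'rV[R]_(dimH L N) :=
  \row_(k < dimH L N)
    if (k < L * (2 * N + 2))%N then
      let l := (k %/ (2 * N + 2))%N in
      let m := (k %% (2 * N + 2))%N in
      if (m < N.+1)%N then
        cos (lams l * th) * p 0 k - sin (lams l * th) * p 0 (inord (k + N.+1))
      else
        sin (lams l * th) * p 0 (inord (k - N.+1)) + cos (lams l * th) * p 0 k
    else p 0 k + lam0 * th.

Definition partial (k n : nat) (phi : 'rV[R]_k -> 'rV[R]_n) (i : 'I_k)
  : 'rV[R]_k -> 'rV[R]_n :=
  fun x => 'D_(delta_mx 0 i) phi x.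

Definition jacobian (k n : nat) (phi : 'rV[R]_k -> 'rV[R]_n) (x : 'rV[R]_k)
  : 'M[R]_(k, n) :=
  \matrix_(i < k, j < n) (partial phi i x) 0 j.

Definition metric (k n : nat) (phi : 'rV[R]_k -> 'rV[R]_n) (x : 'rV[R]_k)
  : 'M[R]_k :=
  jacobian phi x *m (jacobian phi x)^T.

(* mean curvature vector: normal part of g^{ij} d_i d_j phi *)
Definition mean_curvature (k n : nat) (phi : 'rV[R]_k -> 'rV[R]_n)
  (x : 'rV[R]_k) : 'rV[R]_n :=
  let J := jacobian phi x in
  let gi := invmx (metric phi x) in
  let w := \sum_(i < k) \sum_(j < k)
             gi i j *: partial (partial phi j) i x in
  w - w *m J^T *m gi *m J.

Definition C2_embedding (k n : nat) (W : set 'rV[R]_k)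
  (phi : 'rV[R]_k -> 'rV[R]_n) : Prop :=
  [/\ forall x, W x -> differentiable phi x /\
                       (forall i, differentiable (partial phi i) x),
      forall x, W x -> row_free (jacobian phi x),
      {in W &, injective phi} &
      forall x, W x -> forall U : set 'rV[R]_k, open U -> U x ->
        exists O : set 'rV[R]_n, [/\ open O, O (phi x) &
          forall y, W y -> O (phi y) -> U y]].

(* A subset M of R^n is minimal: wherever it is (locally) an embedded
   submanifold, its mean curvature vanishes. *)
Definition minimal_set (n : nat) (M : set 'rV[R]_n) : Prop :=
  forall (k : nat) (W : set 'rV[R]_k) (V : set 'rV[R]_n)
         (phi : 'rV[R]_k -> 'rV[R]_n),
    open W -> open V -> C2_embedding W phi -> phi @` W = M `&` V ->
    forall x, W x -> mean_curvature phi x = 0.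

End Defs.

Arguments Hpoint {R} L N lam lam0 Th r X Y.
Arguments unit_vec {R} N X.
Arguments Hset {R} L N lam lam0 _.
Arguments screw {R} L N lams lam0 th p.
Arguments minimal_set {R} n M.

(* Main.v *)
Require Import Defs.
From HB Require Import structures.
From mathcomp Require Import all_boot all_order all_algebra.
From mathcomp Require Import all_classical all_reals all_analysis.
From mathcomp Require Import zify ring lra.
From Stdlib Require Import Lia.
Import Order.TTheory GRing.Theory Num.Theory.
Import numFieldNormedType.Exports.
Local Open Scope classical_set_scope.
Local Open Scope ring_scope.

(** Curvature is killed by symmetry.  An isometry that maps a set to itself and
    fixes a point [p] of it fixes the mean curvature vector [H] of the set at
    [p].  Besides, [H] is orthogonal to the velocity at [p] of every curve in
    the set.

    Let [p = (r (x) e^(i alpha) (X + i Y), t)].  Reflecting the vector of radii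
    in the line spanned by [r] preserves the set and fixes [p], so that
    [H = (r (x) e^(i alpha) (u + i v), h)].  So does the map which, in the frame
    rotated by [alpha], is [(U + i V, t + s) |-> (O V + i O U, t - s)], where [O] is
    the reflection exchanging [X] and [Y]: hence [h = 0] and [u = O v].  The
    curves moving only [X], resp. only [Y], show that [u = a X] and [v = b Y];
    the ray through [p] gives [a + b = 0], whereas [u = O v] gives [a = b].
    At the singular points [r = 0] the first symmetry is [Z |-> - Z], and the same
    argument applies.

    Twice differentiable parametrizations of the same set need not be related
    through the inverse function theorem: it is enough to compare the second
    order expansions of the height function [<phi, H>] along lifted curves. *)

(** * Estimates for norms, the dot product, and derivatives *)

Lemma diff_near {R : realType} {U V : normedModType R} (f : U -> V) (x : U) (e : R) :
  differentiable f x -> 0 < e ->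
  \forall y \near x, `|f y - f x - 'd f x (y - x)| <= e * `|y - x|.
Proof.
move=> /diff_locally /eqaddoP fx e0.
have := fx _ e0; rewrite near_simpl /= => fe.
rewrite (near_shift 0) subr0 /=; near=> h.
suff : `|(f \o shift x - (cst (f x) + 'd f x)) h| <= e * `|h|.
  by rewrite !fctE /= addrK opprD addrA.
by near: h.
Unshelve. all: by end_near. Qed.

Lemma mx_entry_le_norm {R : realType} {m n : nat} (A : 'M[R]_(m, n)) i j :
  `|A i j| <= `|A|.
Proof.
rewrite [leRHS]/Num.Def.normr /= mx_normrE.
exact: (le_bigmax _ (fun ij : 'I_m * 'I_n => `|A ij.1 ij.2|) (i, j)).
Qed.

Lemma mulmx_lipschitz {R : realType} {m n : nat} (A : 'M[R]_(m, n)) :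
  exists2 c, 0 < c & forall u : 'rV[R]_m, `|u *m A| <= c * `|u|.
Proof.
have c0 : 0 <= m%:R * `|A| by rewrite mulr_ge0.
(* The summand [1] keeps the constant positive when [A = 0] or [m = 0], so that it can be divided
   by. *)
exists (m%:R * `|A| + 1) => [|u]; first lra.
rewrite [leLHS]/Num.Def.normr /= mx_normrE; apply: bigmax_le => [|[i j] _ /=].
  by rewrite mulr_ge0 ?addr_ge0.
rewrite mxE; apply: le_trans (ler_norm_sum _ _ _) _.
apply: (@le_trans _ _ (\sum_(k < m) `|A| * `|u|)); last first.
  rewrite sumr_const card_ord -[leLHS]mulr_natl mulrA ler_wpM2r//; lra.
apply: ler_sum => k _; rewrite normrM mulrC.
by rewrite ler_pM ?mx_entry_le_norm.
Qed.

Lemma cvg_mulmxr {R : realType} {T : Type} {F : set_system T} {FF : Filter F}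
    {m n : nat} (A : 'M[R]_(m, n)) (f : T -> 'rV[R]_m) (l : 'rV[R]_m) :
  f s @[s --> F] --> l -> f s *m A @[s --> F] --> l *m A.
Proof.
move=> fl; have [c c0 cA] := mulmx_lipschitz A.
apply/cvgrPdist_le => e e0.
have ec : 0 < e / c by rewrite divr_gt0.
move/cvgrPdist_le : fl => /(_ _ ec) fl.
near=> s; rewrite -mulmxBl; apply: le_trans (cA _) _.
by rewrite mulrC -ler_pdivlMr//; near: s.
Unshelve. all: by end_near. Qed.

Definition dot {R : realType} {n : nat} (u v : 'rV[R]_n) : R := (u *m v^T) 0 0.

Lemma dotE {R : realType} {n : nat} (u v : 'rV[R]_n) :
  dot u v = \sum_j u 0 j * v 0 j.
Proof. by rewrite /dot mxE; apply: eq_bigr => j _; rewrite mxE. Qed.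

Lemma dotC {R : realType} {n : nat} (u v : 'rV[R]_n) : dot u v = dot v u.
Proof. by rewrite !dotE; apply: eq_bigr => j _; rewrite mulrC. Qed.

Lemma dotDl {R : realType} {n : nat} (u v w : 'rV[R]_n) :
  dot (u + v) w = dot u w + dot v w.
Proof. by rewrite /dot mulmxDl mxE. Qed.

Lemma dotBl {R : realType} {n : nat} (u v w : 'rV[R]_n) :
  dot (u - v) w = dot u w - dot v w.
Proof. by rewrite /dot mulmxBl !mxE. Qed.

Lemma dotZl {R : realType} {n : nat} (a : R) (u v : 'rV[R]_n) :
  dot (a *: u) v = a * dot u v.
Proof. by rewrite /dot -scalemxAl !mxE. Qed.

Lemma dot_suml {R : realType} {n : nat} {I : finType} (u : I -> 'rV[R]_n) v :
  dot (\sum_i u i) v = \sum_i dot (u i) v.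
Proof. by rewrite /dot mulmx_suml summxE. Qed.

Lemma dot_mulmx {R : realType} {m n : nat} (u : 'rV[R]_m) (A : 'M[R]_(m, n)) v :
  dot (u *m A) v = dot u (v *m A^T).
Proof. by rewrite /dot trmx_mul trmxK mulmxA. Qed.

Lemma dot_eq0 {R : realType} {n : nat} (u : 'rV[R]_n) : (dot u u == 0) = (u == 0).
Proof.
rewrite dotE psumr_eq0 => [|i _]; last by rewrite -expr2 sqr_ge0.
apply/idP/eqP => [/allP u0|->]; last by apply/allP => i _ /=; rewrite mxE mul0r.
apply/rowP => j; rewrite mxE; apply/eqP.
by have := u0 j; rewrite mem_index_enum /= -expr2 sqrf_eq0; apply.
Qed.

Lemma differentiable_dotl {R : realType} {U : normedModType R} {n : nat}
    (f : U -> 'rV[R]_n) (v : 'rV[R]_n) (x : U) :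
  differentiable f x -> differentiable (fun y => dot (f y) v) x.
Proof.
move=> df.
have -> : (fun y => dot (f y) v) =
    \sum_(j < n) (fun y => v 0 j *: (f y 0 j : R)) :> (U -> R).
  apply/funext => y; rewrite dotE fct_sumE.
  by apply: eq_bigr => j _; rewrite mulrC.
apply: differentiable_sum => j; apply: differentiableZ.
apply: (@differentiable_comp _ _ _ _ f (fun N : 'rV[R]_n => N 0 j : R)) => //.
exact: differentiable_coord.
Qed.

Lemma derive_dotl {R : realType} {U : normedModType R} {n : nat}
    (f : U -> 'rV[R]_n) (v : 'rV[R]_n) (x h : U) :
  differentiable f x -> 'D_h (fun y => dot (f y) v) x = dot ('D_h f x) v.
Proof.
move=> df; have dfx : derivable f x h by exact: diff_derivable.
rewrite dotE derive_mx//.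
have -> : (fun y => dot (f y) v) =
    \sum_(j < n) (v 0 j \*: (fun y => f y 0 j : R)) :> (U -> R).
  apply/funext => y; rewrite dotE fct_sumE.
  by apply: eq_bigr => j _; rewrite mulrC.
rewrite derive_sum => [|j]; last first.
  by apply: derivableZ; move/derivable_mxP: dfx; apply.
apply: eq_bigr => j _; rewrite deriveZ ?mxE 1?mulrC//.
by move/derivable_mxP: dfx; apply.
Qed.

Lemma is_derive0_cvg {R : realType} {V : normedModType R} (g : R -> V) (v : V) :
  is_derive (0 : R) (1 : R) g v ->
  s^-1 *: (g s - g 0) @[s --> (0:R)^'] --> v.
Proof.
case=> /cvg_ex [l gl] <-; rewrite /derive.
have /cvg_lim -> // := gl.
suff <- : (fun h : R => h^-1 *: ((g \o shift 0) (h *: (1 : R)) - g 0)) =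
          (fun s => s^-1 *: (g s - g 0)) by [].
by apply/funext => s /=; rewrite addr0 -[s *: 1]/(s * 1) mulr1.
Qed.

Lemma is_derive_line {R : realType} {U V : normedModType R} {f : U -> V} {x h : U} {s : R} :
  derivable f (x + s *: h) h ->
  is_derive s (1 : R) (fun s => f (x + s *: h)) ('D_h f (x + s *: h)).
Proof.
have E : (fun t : R => t^-1 *: (((fun s => f (x + s *: h)) \o shift s) (t *: (1 : R)) -
      f (x + s *: h))) =
    (fun t => t^-1 *: ((f \o shift (x + s *: h)) (t *: h) - f (x + s *: h))).
  apply/funext => t /=; congr (_ *: (f _ - _)).
  by rewrite -[t *: 1]/(t * 1) mulr1 scalerDl addrCA.
by move=> fd; apply: DeriveDef; rewrite /derivable /derive E.
Qed.

Lemma diff_jacobian {R : realType} {k n : nat} (phi : 'rV[R]_k -> 'rV[R]_n) x h :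
  differentiable phi x -> 'd phi x h = h *m Defs.jacobian phi x.
Proof.
move=> dx; rewrite -deriveE// derivemxE//; congr (_ *m _).
by apply/matrixP => i j; rewrite !mxE -deriveE.
Qed.

(** * Curves and second order expansions *)

(** The lift [c] is chosen pointwise: its continuity at [0] is the embedding
    property, and its velocity comes from the left inverse [G] of the Jacobian. *)
Lemma lift_curve {R : realType} {k n : nat} {M V : set 'rV[R]_n} {W : set 'rV[R]_k}
    {phi : 'rV[R]_k -> 'rV[R]_n} {x : 'rV[R]_k} {G : 'M[R]_(n, k)}
    {g : R -> 'rV[R]_n} {v : 'rV[R]_n} :
  open W -> open V -> C2_embedding W phi -> phi @` W = M `&` V -> W x ->
  Defs.jacobian phi x *m G = 1%:M ->
  (\forall s \near (0:R)^', M (g s)) -> g 0 = phi x -> is_derive (0 : R) (1 : R) g v ->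
  exists c : R -> 'rV[R]_k,
    [/\ \forall s \near (0:R)^', phi (c s) = g s,
        s^-1 *: (c s - x) @[s --> (0:R)^'] --> v *m G &
        v *m G *m Defs.jacobian phi x = v].
Proof.
move=> oW oV [dphi _ _ hom] im Wx JG Mg g0 dg.
set J := Defs.jacobian phi x in JG *.
have gc : g s @[s --> (0:R)^'] --> phi x.
  apply: cvg_within_filter; rewrite -g0.
  apply: differentiable_continuous; apply/derivable1_diffP.
  exact: ex_derive.
have Vx : V (phi x).
  have : (phi @` W) (phi x) by exists x.
  by rewrite im => -[].
(* The default [x] is not taken for small [s != 0]: there [g s] lies in [M] and in [V], hence in the
   image of [W]. *)
pose c s := xget x [set y | W y /\ phi y = g s].
have cP : \forall s \near (0:R)^', W (c s) /\ phi (c s) = g s.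
  have : \forall s \near (0:R)^', V (g s) by apply: gc; exact: open_nbhs_nbhs.
  apply: filterS2 Mg => s Ms Vs; apply: (@xgetPex _ x [set y | W y /\ phi y = g s]).
  have : (M `&` V) (g s) by [].
  by rewrite -im => -[y Wy <-]; exists y.
have cx : c s @[s --> (0:R)^'] --> x.
  move=> U; rewrite nbhsE => -[B [oB Bx] BU].
  have [Q [oQ Qx QB]] := hom x Wx B oB Bx.
  have : \forall s \near (0:R)^', Q (g s) by apply: gc; exact: open_nbhs_nbhs.
  by apply: filterS2 cP => s [Wc cg] Qg; apply: BU; apply: QB => //; rewrite cg.
have dJ h : 'd phi x h = h *m J by rewrite -diff_jacobian//; case: (dphi x Wx).
pose q s := s^-1 *: (g s - g 0).
have qv : q s @[s --> (0:R)^'] --> v by exact: is_derive0_cvg.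
(* This is the first order remainder of [phi] at [x] along [c]. It is known to be small relative to
   [c s - x]; once [c s - x = O(s)] is proved, it is also small relative to [s]. *)
pose rem s := g s - g 0 - (c s - x) *m J.
have remle e : 0 < e -> \forall s \near (0:R)^', `|rem s| <= e * `|c s - x|.
  move=> e0; have [dx _] := dphi x Wx.
  have := cx _ (@diff_near _ _ _ phi x e dx e0).
  rewrite near_simpl /= => H; apply: filterS2 cP H => s [_ cg].
  by rewrite /= cg dJ /rem g0.
have [K K0 KG] := mulmx_lipschitz G.
(* Multiplying by [G] bounds [|c s - x|] by [K (|v| + 1) |s| + K |rem s|]. With
   [|rem s| <= |c s - x| / (2 K)] the last term is absorbed into the left side, which doubles the
   constant. *)
pose B := 2 * K * (`|v| + 1).
have v1 : 0 < `|v| + 1 by rewrite ltr_wpDl.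
have B0 : 0 < B by rewrite !mulr_gt0.
have cE s : c s - x = (g s - g 0) *m G - rem s *m G.
  by rewrite -mulmxBl /rem subKr -mulmxA JG mulmx1.
have cB : \forall s \near (0:R)^', `|c s - x| <= B * `|s|.
  have K2 : 0 < (2 * K)^-1 by rewrite invr_gt0 mulr_gt0.
  have /cvgrPdist_le /(_ _ ltr01) qv1 := qv.
  near=> s.
  have s0 : s != 0 by near: s; exact: nbhs_dnbhs_neq.
  have gs : `|g s - g 0| <= (`|v| + 1) * `|s|.
    have -> : g s - g 0 = s *: q s by rewrite /q scalerA divff// scale1r.
    rewrite normrZ mulrC ler_wpM2r//.
    have : `|v - q s| <= 1 by near: s.
    have := ler_normB v (v - q s); rewrite subKr; lra.
  have rs : `|rem s| <= (2 * K)^-1 * `|c s - x| by near: s; exact: remle.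
  have := ler_normB ((g s - g 0) *m G) (rem s *m G); rewrite -cE.
  have := KG (g s - g 0); have := KG (rem s).
  have : K * `|rem s| <= 2^-1 * `|c s - x|.
    have -> : 2^-1 * `|c s - x| = K * ((2 * K)^-1 * `|c s - x|).
      by field; apply/eqP => Kz; rewrite Kz ltxx in K0.
    by rewrite ler_pM2l.
  have : K * `|g s - g 0| <= K * ((`|v| + 1) * `|s|) by rewrite ler_pM2l.
  rewrite /B; lra.
have rem0 : s^-1 *: rem s @[s --> (0:R)^'] --> (0 : 'rV[R]_n).
  apply/cvgrPdist_le => e e0; near=> s.
  have s0 : s != 0 by near: s; exact: nbhs_dnbhs_neq.
  rewrite sub0r normrN normrZ normfV mulrC ler_pdivrMr ?normr_gt0//.
  have : `|rem s| <= e / B * `|c s - x|.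
    by near: s; apply: remle; rewrite divr_gt0.
  move=> /le_trans; apply; rewrite -mulrA ler_pM2l// ler_pdivrMl//.
  by near: s.
have cG : s^-1 *: (c s - x) @[s --> (0:R)^'] --> v *m G.
  rewrite -[v *m G]subr0 -[in X in _ --> X](mul0mx 1 G).
  rewrite [X in X @ _ --> _](_ : _ = fun s => q s *m G - (s^-1 *: rem s) *m G).
    by apply: cvgB; exact: cvg_mulmxr.
  by apply/funext => s; rewrite cE /q -!scalemxAl scalerBr.
exists c; split => //; first by apply: filterS cP => s [].
(* The same quotient has the limits [v] and [v *m G *m J], which are therefore equal: [v] is
   tangent. *)
have qJ : s^-1 *: (c s - x) *m J @[s --> (0:R)^'] --> v.
  rewrite -[X in _ --> X]subr0.
  rewrite [X in X @ _ --> _](_ : _ = fun s => q s - s^-1 *: rem s); first exact: cvgB.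
  by apply/funext => s; rewrite /q -scalerBr /rem subKr scalemxAl.
have qG : s^-1 *: (c s - x) *m J @[s --> (0:R)^'] --> v *m G *m J.
  exact: cvg_mulmxr.
by move/cvg_lim : qG => <- //; move/cvg_lim : qJ => ->.
Unshelve. all: by end_near. Qed.

(** [g j] is a second name for the [j]-th partial derivative, which is only known
    to coincide with a differentiable function near [x]. *)
Lemma second_order_near {R : realType} {k : nat} {f : 'rV[R]_k -> R}
    {g : 'I_k -> 'rV[R]_k -> R} {x : 'rV[R]_k} :
  (\forall y \near x, differentiable f y /\
     forall j, 'D_(delta_mx 0 j) f y = g j y) ->
  (forall j, differentiable (g j) x) ->
  (forall j, g j x = 0) ->
  let B := \matrix_(i, j) 'D_(delta_mx 0 i) (g j) x in
  forall e, 0 < e -> \forall y \near x,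
    `|f y - f x - 2^-1 * dot ((y - x) *m B) (y - x)| <= e * `|y - x| ^+ 2.
Proof.
move=> df ddf Df0 B e e0.
have k1 : 0 < k%:R + 1 :> R by rewrite ltr_wpDl.
(* The final sum has [k] terms, each at most [e' * |h| ^ 2]; adding [1] covers [k = 0]. *)
pose e' := e / (k%:R + 1); have e'0 : 0 < e' by rewrite divr_gt0.
have gB j (h : 'rV[R]_k) : 'd (g j) x h = (h *m B) 0 j.
  have Eh : h = \sum_i h 0 i *: delta_mx 0 i by exact: row_sum_delta.
  rewrite {1}Eh linear_sum [RHS]mxE; apply: eq_bigr => i _.
  rewrite linearZ /= -deriveE; last exact: ddf.
  by rewrite /B mxE.
have gnear : \forall y \near x, forall j : 'I_k,
    `|g j y - ((y - x) *m B) 0 j| <= e' * `|y - x|.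
  apply: (@filter_forall _ _
    (fun j y => `|g j y - ((y - x) *m B) 0 j| <= e' * `|y - x|) (nbhs x) _) => j.
  have := @diff_near _ _ _ (g j) x e' (ddf j) e'0.
  by apply: filterS => y; rewrite /= gB Df0 subr0.
have /nbhs_ballP [r /= r0 ball_r] : \forall y \near x, (differentiable f y /\
    forall j : 'I_k, 'D_(delta_mx 0 j) f y = g j y) /\
    forall j : 'I_k, `|g j y - ((y - x) *m B) 0 j| <= e' * `|y - x|.
  by near=> y; split; near: y.
have {}ball_r y : `|y - x| < r -> (differentiable f y /\
    forall j : 'I_k, 'D_(delta_mx 0 j) f y = g j y) /\
    forall j : 'I_k, `|g j y - ((y - x) *m B) 0 j| <= e' * `|y - x|.
  by move=> yr; apply: ball_r; rewrite /= -ball_normE /= distrC.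
near=> y; set h := y - x.
have hr : `|h| < r.
  rewrite /h; near: y; apply/nbhs_ballP; exists r => // z.
  by rewrite -ball_normE /= distrC.
have shr (s : R) : 0 <= s <= 1 -> `|x + s *: h - x| < r.
  move=> /andP[s0 s1]; rewrite addrC addKr normrZ ger0_norm//.
  by apply: le_lt_trans hr; rewrite ler_piMl.
(* The mean value theorem on the segment from [x] to [y] turns the second order remainder of [f]
   into [dF z], a combination of the first order remainders of the [g j]. *)
pose F (s : R) := f (x + s *: h) - 2^-1 * s ^+ 2 * dot (h *m B) h.
pose dF (s : R) := \sum_j h 0 j * g j (x + s *: h) - s * dot (h *m B) h.
have dfh (s : R) : 0 <= s <= 1 ->
    is_derive s (1 : R) (fun s : R => f (x + s *: h)) (\sum_j h 0 j * g j (x + s *: h)).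
  move=> s01; have [[dfs Dfs] _] := ball_r _ (shr s s01).
  suff -> : \sum_j h 0 j * g j (x + s *: h) = 'D_h f (x + s *: h).
    by apply: is_derive_line; exact: diff_derivable.
  set p := x + s *: h in dfs Dfs *.
  rewrite deriveE// [in RHS](row_sum_delta h) linear_sum; apply: eq_bigr => i _.
  by rewrite linearZ /= -deriveE// Dfs.
have FdF (s : R) : 0 <= s <= 1 -> is_derive s (1 : R) F (dF s).
  move=> /dfh H; rewrite /F /dF.
  have -> : (fun s => f (x + s *: h) - 2^-1 * s ^+ 2 * dot (h *m B) h) =
      (fun s : R => f (x + s *: h)) - (2^-1 * dot (h *m B) h) \*: (id ^+ 2).
    by apply/funext => t; rewrite !fctE /= -[(_ * dot _ _) *: _]/(_ * _); ring.
  apply: is_derive_eq.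
  rewrite /= expr1 -[_%:A]/(_ * 1) -[(_ * dot _ _) *: _]/(_ * _); by field.
have [z z01 Fz] : exists2 z, z \in `[0, 1]%R & F 1 - F 0 = dF z * (1 - 0).
  apply: MVT_segment => //.
    by move=> s; rewrite in_itv /= => /andP[/ltW ? /ltW ?]; apply: FdF; apply/andP.
  apply: continuous_in_subspaceT => s; rewrite inE /= in_itv /= => s01.
  apply: differentiable_continuous; apply/derivable1_diffP.
  by have [] := FdF s s01.
have -> : f y - f x - 2^-1 * dot (h *m B) h = dF z.
  move: Fz; rewrite subr0 mulr1 => <-.
  by rewrite /F scale1r scale0r addr0 /h subrKC; ring.
have {}z01 : 0 <= z <= 1 by move: z01; rewrite in_itv.
have [_ gz] := ball_r _ (shr z z01).
have zE : x + z *: h - x = z *: h by rewrite addrC addKr.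
have -> : dF z = \sum_j h 0 j * (g j (x + z *: h) - ((x + z *: h - x) *m B) 0 j).
  rewrite /dF dotE mulr_sumr -sumrB; apply: eq_bigr => j _.
  by rewrite zE -scalemxAl mulrBr [X in _ = _ - _ * X]mxE; ring.
have zh : `|x + z *: h - x| <= `|h|.
  move/andP: z01 => [z0 z1].
  by rewrite zE normrZ ger0_norm// ler_piMl.
apply: le_trans (ler_norm_sum _ _ _) _.
apply: (@le_trans _ _ (\sum_(j < k) `|h| * (e' * `|h|))).
  apply: ler_sum => j _; rewrite normrM ler_pM ?mx_entry_le_norm//.
  by apply: le_trans (gz j) _; rewrite ler_pM2l.
rewrite sumr_const card_ord -[leLHS]mulr_natl expr2.
rewrite [leLHS](_ : _ = k%:R / (k%:R + 1) * (e * (`|h| * `|h|))); last first.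
  by rewrite /e'; field; apply/eqP => k0; rewrite k0 ltxx in k1.
rewrite ler_piMl ?mulr_ge0 ?(ltW e0)//.
by rewrite ler_pdivrMr// mul1r lerDl.
Unshelve. all: by end_near. Qed.

Lemma cvg_dot {R : realType} {T : Type} {F : set_system T} {FF : Filter F} {n : nat}
    (f g : T -> 'rV[R]_n) (a b : 'rV[R]_n) :
  f s @[s --> F] --> a -> g s @[s --> F] --> b ->
  dot (f s) (g s) @[s --> F] --> dot a b.
Proof.
move=> fa gb; rewrite dotE.
rewrite [X in X @ _ --> _](_ : _ = fun s => \sum_j f s 0 j * g s 0 j); last first.
  by apply/funext => s; rewrite dotE.
have coord (h : T -> 'rV[R]_n) (l : 'rV[R]_n) j :
    h s @[s --> F] --> l -> h s 0 j @[s --> F] --> l 0 j.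
  move=> hl; apply: (cvg_comp _ (fun N : 'rV[R]_n => N 0 j) hl).
  exact: coord_continuous.
apply: (@cvg_big _ _ +%R) => [|j _]; first exact: add_continuous.
by apply: cvgM; exact: coord.
Qed.

(** Since the gradient vanishes at [x], the acceleration of [c] does not enter: the velocity alone
    determines the limit, and [c] need not be twice differentiable. *)
Lemma second_order_curve {R : realType} {k : nat} {f : 'rV[R]_k -> R}
    {g : 'I_k -> 'rV[R]_k -> R} {x : 'rV[R]_k} {c : R -> 'rV[R]_k} {u : 'rV[R]_k} :
  (\forall y \near x, differentiable f y /\
     forall j, 'D_(delta_mx 0 j) f y = g j y) ->
  (forall j, differentiable (g j) x) ->
  (forall j, g j x = 0) ->
  s^-1 *: (c s - x) @[s --> (0:R)^'] --> u ->
  s^-1 ^+ 2 * (f (c s) - f x) @[s --> (0:R)^'] -->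
    2^-1 * dot (u *m \matrix_(i, j) 'D_(delta_mx 0 i) (g j) x) u.
Proof.
move=> df ddf g0 cu; set B := \matrix_(i, j) _.
pose d (s : R) := s^-1 *: (c s - x).
have dE (s : R) : s != 0 -> c s - x = s *: d s.
  by move=> s0; rewrite /d scalerA divff// scale1r.
have cx : c s @[s --> (0:R)^'] --> x.
  have : x + s *: d s @[s --> (0:R)^'] --> x + (0:R) *: u.
    apply: cvgD; first exact: cvg_cst.
    by apply: cvgZ => //; apply: cvg_within_filter; exact: cvg_id.
  rewrite scale0r addr0; apply: cvg_trans; apply: near_eq_cvg; near=> s.
  by rewrite -dE ?subrKC//; near: s; exact: nbhs_dnbhs_neq.
have Q : 2^-1 * dot (d s *m B) (d s) @[s --> (0:R)^'] --> 2^-1 * dot (u *m B) u.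
  by apply: cvgM; [exact: cvg_cst | apply: cvg_dot => //; exact: cvg_mulmxr].
rewrite -[X in _ --> X]addr0.
rewrite [X in X @ _ --> _](_ : _ = fun s => 2^-1 * dot (d s *m B) (d s) +
    (s^-1 ^+ 2 * (f (c s) - f x) - 2^-1 * dot (d s *m B) (d s))); last first.
  by apply/funext => s; rewrite subrKC.
apply: cvgD => //; apply/cvgrPdist_le => e e0.
have u1 : 0 < `|u| + 1 by rewrite ltr_wpDl.
(* Near [0] the quotient [d s] is bounded by [|u| + 1], whose square this tolerance compensates. *)
have e'0 : 0 < e / (`|u| + 1) ^+ 2 by rewrite divr_gt0// exprn_gt0.
have := cx _ (second_order_near df ddf g0 _ e'0).
rewrite near_simpl /= => H.
have /cvgrPdist_le /(_ _ ltr01) du := cu.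
near=> s.
have s0 : s != 0 by near: s; exact: nbhs_dnbhs_neq.
have dsu : `|d s| <= `|u| + 1.
  have : `|u - d s| <= 1 by near: s.
  have := ler_normB u (u - d s); rewrite subKr; lra.
have : `|f (c s) - f x - 2^-1 * dot ((c s - x) *m B) (c s - x)| <=
    e / (`|u| + 1) ^+ 2 * `|c s - x| ^+ 2 by near: s.
rewrite dE// -scalemxAl dotZl [dot _ (s *: _)]dotC dotZl [dot (d s) _]dotC.
rewrite normrZ exprMn => Hs.
rewrite sub0r normrN.
have -> : s^-1 ^+ 2 * (f (c s) - f x) - 2^-1 * dot (d s *m B) (d s) =
   s^-1 ^+ 2 * (f (c s) - f x - 2^-1 * (s * (s * dot (d s *m B) (d s)))) by field.
rewrite normrM normrX normfV exprVn mulrC ler_pdivrMr ?exprn_gt0 ?normr_gt0//.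
apply: le_trans Hs _.
rewrite mulrCA mulrC ler_wpM2r ?exprn_ge0//.
rewrite -mulrA ler_piMr ?(ltW e0)// mulrC ler_pdivrMr ?exprn_gt0// mul1r.
by rewrite lerXn2r// nnegrE// ltW.
Unshelve. all: by end_near. Qed.

(** * Mean curvature and isometries *)

(** If [y *m J *m J^T = 0], then [y *m J] has squared norm [0], and [y = 0] by freeness. *)
Lemma gram_unitmx {R : realType} {k n : nat} (J : 'M[R]_(k, n)) :
  row_free J -> J *m J^T \in unitmx.
Proof.
move=> fJ; rewrite -row_free_unit -kermx_eq0.
apply/eqP/row_matrixP => i; rewrite row0.
have kJ : row i (kermx (J *m J^T)) *m J = 0.
  apply/eqP; rewrite -dot_eq0 dot_mulmx -mulmxA.
  by rewrite -[in X in dot _ X]row_mul mulmx_ker row0 /dot trmx0 mulmx0 mxE.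
by apply: (row_free_inj fJ); rewrite kJ mul0mx.
Qed.

Lemma mean_curvature_normal {R : realType} {k n : nat} {phi : 'rV[R]_k -> 'rV[R]_n} {x} :
  row_free (Defs.jacobian phi x) ->
  mean_curvature phi x *m (Defs.jacobian phi x)^T = 0.
Proof.
move=> /gram_unitmx gu; rewrite /mean_curvature; set w := \sum_i _.
by rewrite mulmxBl -!mulmxA mulVmx// mulmx1 subrr.
Qed.

(** Lifting the curve shows that its velocity is in the row space of the Jacobian, to which the mean
    curvature vector is orthogonal. *)
Lemma mean_curvature_dot_velocity {R : realType} {k n : nat} {M V : set 'rV[R]_n}
    {W : set 'rV[R]_k} {phi : 'rV[R]_k -> 'rV[R]_n} {x : 'rV[R]_k}
    {g : R -> 'rV[R]_n} {v : 'rV[R]_n} :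
  open W -> open V -> C2_embedding W phi -> phi @` W = M `&` V -> W x ->
  (\forall s \near (0:R)^', M (g s)) -> g 0 = phi x -> is_derive (0 : R) (1 : R) g v ->
  dot (mean_curvature phi x) v = 0.
Proof.
move=> oW oV ephi im Wx Mg g0 dg; have [_ /(_ _ Wx) fJ _ _] := ephi.
have JG : Defs.jacobian phi x *m ((Defs.jacobian phi x)^T *m invmx (metric phi x)) = 1%:M.
  by rewrite mulmxA mulmxV// gram_unitmx.
have [c [_ _ <-]] := lift_curve oW oV ephi im Wx JG Mg g0 dg.
by rewrite dotC dot_mulmx mean_curvature_normal// /dot trmx0 mulmx0 mxE.
Qed.

Lemma quadratic_form_eq0 {R : realType} {k : nat} (Q : 'M[R]_k) :
  (forall h, dot (h *m Q) h = 0) -> Q^T = - Q.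
Proof.
move=> Q0; apply/matrixP => i j; rewrite !mxE.
have E a b : dot (delta_mx 0 a *m Q) (delta_mx 0 b) = Q a b.
  rewrite -rowE dotE (bigD1 b)//= big1 => [|c /negbTE cb]; rewrite !mxE.
    by rewrite !eqxx mulr1 addr0.
  by rewrite cb andbF mulr0.
(* Polarization on pairs of basis vectors. *)
have := Q0 (delta_mx 0 i + delta_mx 0 j).
rewrite mulmxDl dotDl ![dot _ (_ + _)]dotC !dotDl ![dot (delta_mx _ _) _]dotC !E.
have := Q0 (delta_mx 0 i); have := Q0 (delta_mx 0 j); rewrite !E; lra.
Qed.

(** [B] and [B'] are not assumed symmetric, so only their symmetric parts are
    related; this suffices because [invmx g] is symmetric. *)
Lemma trace_gram_congruence {R : realType} {k : nat} {g A B B' : 'M[R]_k} :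
  g \in unitmx -> g^T = g -> A *m g *m A^T = g ->
  (forall h, dot (h *m A *m B) (h *m A) = dot (h *m B') h) ->
  \tr (invmx g *m B') = \tr (invmx g *m B).
Proof.
move=> gu gT AgA BB'.
have AA : A *m (g *m A^T *m invmx g) = 1%:M by rewrite !mulmxA AgA mulmxV.
(* A right inverse of the square matrix [A] is also a left inverse, so the invariance of [g] passes
   to its inverse. *)
have Ag : A^T *m invmx g *m A = invmx g.
  have /(congr1 (mulmx (invmx g))) := mulmx1C AA.
  by rewrite mulmx1 !mulmxA mulVmx// mul1mx.
have QT : (B' - A *m B *m A^T)^T = - (B' - A *m B *m A^T).
  apply: quadratic_form_eq0 => h.
  by rewrite mulmxBr dotBl -BB' !mulmxA [X in _ - X]dot_mulmx trmxK subrr.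
(* A symmetric matrix times an antisymmetric one has trace [0]. *)
have : \tr (invmx g *m (B' - A *m B *m A^T)) = 0.
  have := mxtrace_tr (invmx g *m (B' - A *m B *m A^T)).
  rewrite trmx_mul QT trmx_inv gT mulNmx raddfN /= mxtrace_mulC.
  lra.
rewrite mulmxBr raddfB /= => /eqP; rewrite subr_eq0 => /eqP ->.
by rewrite !mulmxA mxtrace_mulC !mulmxA Ag.
Qed.

Lemma is_derive_mulmxr {R : realType} {U : normedModType R} {m n : nat}
    {f : U -> 'rV[R]_m} {df : 'rV[R]_m} {x v : U} (A : 'M[R]_(m, n)) :
  is_derive x v f df -> is_derive x v (fun y => f y *m A) (df *m A).
Proof.
case=> /cvg_ex [l fl] <-; have -> : 'D_v f x = l by exact: cvg_lim fl.
have E : (fun t : R => t^-1 *: (((fun y => f y *m A) \o shift x) (t *: v) - f x *m A)) =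
    (fun t => t^-1 *: ((f \o shift x) (t *: v) - f x) *m A).
  by apply/funext => t; rewrite /= -mulmxBl scalemxAl.
have L : t^-1 *: (((fun y => f y *m A) \o shift x) (t *: v) - f x *m A)
    @[t --> (0:R)^'] --> l *m A by rewrite E; exact: cvg_mulmxr.
by apply: DeriveDef; [apply/cvg_ex; eexists; exact: L | exact: cvg_lim L].
Qed.

(** Equality case of Cauchy-Schwarz. As [S] preserves the tangent space, the tangential part of [w]
    drops out and [H *m S] has the same dot product with [H] as [H] itself. The two vectors have
    equal norms, so their difference has norm [0]. *)
Lemma normal_fixed {R : realType} {k n : nat} {H w : 'rV[R]_n} {S : 'M[R]_n}
    {J : 'M[R]_(k, n)} {A : 'M[R]_k} {z : 'rV[R]_k} :
  S *m S^T = 1%:M -> H *m J^T = 0 -> A *m J = J *m S -> w = H + z *m J ->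
  dot w (H *m S^T) = dot w H -> H *m S = H.
Proof.
move=> SS HJ AJ wE wH.
have tan0 y : dot (y *m J) H = 0 by rewrite dot_mulmx HJ /dot trmx0 mulmx0 mxE.
have HH : dot (H *m S) H = dot H H.
  have <- : dot w H = dot H H by rewrite wE dotDl tan0 addr0.
  rewrite -wH wE dotDl -(dot_mulmx H S H) -(dot_mulmx (z *m J) S H).
  by rewrite -(mulmxA z J S) -AJ mulmxA tan0 addr0.
apply/eqP; rewrite -subr_eq0 -dot_eq0 dotBl ![dot _ (_ - _)]dotC !dotBl.
rewrite [dot H (H *m S)]dotC HH [dot (H *m S) (H *m S)]dot_mulmx -mulmxA SS mulmx1.
by rewrite !subrr.
Qed.

(** The isometry sends the image of the line [x + s h] to a curve in [M], which lifts with velocity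
    [h *m A]. Thus [A] is the isometry read in the chart to first order. Comparing heights along the
    lift and along the line relates two Hessians, and tracing with the inverse metric leaves a
    statement about [w] alone. *)
Lemma mean_curvature_isometry {R : realType} {k n : nat} {M V : set 'rV[R]_n}
    {W : set 'rV[R]_k} {phi : 'rV[R]_k -> 'rV[R]_n} {x : 'rV[R]_k}
    {S : 'M[R]_n} {b : 'rV[R]_n} :
  open W -> open V -> C2_embedding W phi -> phi @` W = M `&` V -> W x ->
  S *m S^T = 1%:M -> (forall q, M q -> M (q *m S + b)) ->
  phi x *m S + b = phi x ->
  mean_curvature phi x *m S = mean_curvature phi x.
Proof.
move=> oW oV ephi im Wx SS MS xS; have [dphi /(_ _ Wx) fJ _ _] := ephi.
set H := mean_curvature phi x.
set J := Defs.jacobian phi x; set g := metric phi x.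
pose G := J^T *m invmx g.
have gu : g \in unitmx by exact: gram_unitmx.
have JG : J *m G = 1%:M by rewrite mulmxA mulmxV.
have HJ : H *m J^T = 0 by exact: mean_curvature_normal.
have [dx ddx] := dphi _ Wx.
have DJ j : partial phi j x = delta_mx 0 j *m J.
  by rewrite /partial deriveE// diff_jacobian.
have Wnear : \forall y \near x, W y by exact: open_nbhs_nbhs.
have MW y : W y -> M (phi y).
  by move=> Wy; have : (phi @` W) (phi y) by [exists y]; rewrite im => -[].
have line0 (h : 'rV[R]_k) : x + s *: h @[s --> (0:R)^'] --> x.
  suff : x + s *: h @[s --> (0:R)^'] --> x + (0 : R) *: h by rewrite scale0r addr0.
  apply: cvgD; first exact: cvg_cst.
  apply: cvgZ; last exact: cvg_cst.
  by apply: cvg_within_filter; exact: cvg_id.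
have curve (h : 'rV[R]_k) : exists c : R -> 'rV[R]_k,
    [/\ \forall s \near (0:R)^', phi (c s) = phi (x + s *: h) *m S + b,
        s^-1 *: (c s - x) @[s --> (0:R)^'] --> h *m J *m S *m G &
        h *m J *m S *m G *m J = h *m J *m S].
  apply: (lift_curve oW oV ephi im Wx JG).
  - have : \forall s \near (0:R)^', W (x + s *: h) by apply: line0.
    by apply: filterS => s /MW /MS.
  - by rewrite scale0r addr0.
  - rewrite -[X in is_derive _ _ _ X]addr0; apply: is_deriveD.
    apply: is_derive_mulmxr; rewrite -diff_jacobian// -deriveE//.
    have -> : 'D_h phi x = 'D_h phi (x + (0:R) *: h) by rewrite scale0r addr0.
    by apply: is_derive_line; rewrite scale0r addr0; exact: diff_derivable.
pose A := J *m S *m G.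
have AJ : A *m J = J *m S.
  apply/row_matrixP => i; have [c [_ _ E]] := curve (delta_mx 0 i).
  by rewrite !rowE !mulmxA; move: E; rewrite /G !mulmxA.
have AgA : A *m g *m A^T = g.
  rewrite /g /metric -/J !mulmxA AJ -[_ *m J^T *m A^T]mulmxA -trmx_mul AJ.
  by rewrite trmx_mul mulmxA -(mulmxA J) SS mulmx1.
pose gn (u : 'rV[R]_n) j y := dot (partial phi j y) u.
pose B (u : 'rV[R]_n) := \matrix_(i, j) 'D_(delta_mx 0 i) (gn u j) x.
have dphiu u : \forall y \near x, differentiable (fun y => dot (phi y) u) y /\
     forall j, 'D_(delta_mx 0 j) (fun y => dot (phi y) u) y = gn u j y.
  apply: filterS Wnear => y /dphi [dy _]; split; first exact: differentiable_dotl.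
  by move=> j; rewrite derive_dotl.
have dgn u j : differentiable (gn u j) x by apply: differentiable_dotl.
(* Both height functions are critical at [x]: [H] is normal, and so is [H *m S^T] because [S] maps
   tangent vectors to tangent vectors. *)
have H0 j : gn H j x = 0.
  by rewrite /gn DJ dot_mulmx HJ /dot trmx0 mulmx0 mxE.
have HS0 j : gn (H *m S^T) j x = 0.
  rewrite /gn DJ -{1}[S]trmxK.
  by rewrite -dot_mulmx trmxK -mulmxA -AJ mulmxA dot_mulmx HJ /dot trmx0 mulmx0 mxE.
(* The height along [H] of the lifted curve and the height along [H *m S^T] of the line have equal
   increments, since [b] cancels; hence their second order limits agree. *)
have quad h : dot (h *m A *m B H) (h *m A) = dot (h *m B (H *m S^T)) h.
  have [c [cE cA _]] := curve h.
  have -> : h *m A = h *m J *m S *m G by rewrite !mulmxA.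
  have L1 := second_order_curve (dphiu H) (dgn H) H0 cA.
  have ch : s^-1 *: (x + s *: h - x) @[s --> (0:R)^'] --> h.
    have hh : h @[_ --> (0:R)^'] --> h by exact: cvg_cst.
    apply: cvg_trans hh; apply: near_eq_cvg; near=> s.
    rewrite addrC addKr scalerA mulVf ?scale1r//.
    by near: s; exact: nbhs_dnbhs_neq.
  have L2 := second_order_curve (dphiu (H *m S^T)) (dgn (H *m S^T)) HS0 ch.
  apply: (mulfI (x := 2^-1)); first by rewrite invr_neq0.
  move/cvg_lim: L2 => <- //.
  apply/esym/cvg_lim => //.
  apply: cvg_trans L1; apply: near_eq_cvg; near=> s; congr (_ * _).
  have -> : phi (c s) = phi (x + s *: h) *m S + b by near: s.
  have -> : dot (phi x) H = dot (phi x *m S) H + dot b H by rewrite -dotDl xS.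
  by rewrite dotDl !dot_mulmx; ring.
have trB u : \tr (invmx g *m B u) = dot (\sum_(i < k) \sum_(j < k)
    invmx g i j *: partial (partial phi j) i x) u.
  have giT : (invmx g)^T = invmx g by rewrite trmx_inv /g /metric trmx_mul trmxK.
  rewrite -[X in \tr (X *m _)]giT /mxtrace dot_suml.
  under [RHS]eq_bigr => i _ do rewrite dot_suml.
  rewrite [RHS]exchange_big /=; apply: eq_bigr => j _.
  rewrite mxE; apply: eq_bigr => i _.
  by rewrite dotZl [B u]lock !mxE -lock mxE derive_dotl.
have gT : g^T = g by rewrite /g /metric trmx_mul trmxK.
have := trace_gram_congruence gu gT AgA quad.
rewrite !trB; set w := \sum_i _ => wH.
have [z wE] : exists z, w = H + z *m J.
  by exists (w *m J^T *m invmx g); rewrite /H /mean_curvature -/w subrK.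
exact: (normal_fixed SS HJ AJ wE wH).
Unshelve. all: by end_near. Qed.

(** * Rotated frames and symmetries of the set *)

(** Block [l] is [e^(i alpha) (U l + i V l)]; the last coordinate is [t]. *)
Definition frame {R : realType} (L N : nat) (alpha : R) (U V : nat -> nat -> R) (t : R)
  : 'rV[R]_(dimH L N) :=
  \row_(k < dimH L N)
    if (k < L * (2 * N + 2))%N then
      let l := (k %/ (2 * N + 2))%N in
      let m := (k %% (2 * N + 2))%N in
      if (m < N.+1)%N then cos alpha * U l m - sin alpha * V l m
      else sin alpha * U l (m - N.+1)%N + cos alpha * V l (m - N.+1)%N
    else t.

(** Together with [frame_im], these are the real and imaginary parts of [e^(- i alpha) q]. *)
Definition frame_re {R : realType} {L N : nat} (alpha : R) (q : 'rV[R]_(dimH L N)) l m : R :=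
  cos alpha * q 0 (inord (l * (2 * N + 2) + m)) +
  sin alpha * q 0 (inord (l * (2 * N + 2) + (m + N.+1))).

Definition frame_im {R : realType} {L N : nat} (alpha : R) (q : 'rV[R]_(dimH L N)) l m : R :=
  cos alpha * q 0 (inord (l * (2 * N + 2) + (m + N.+1))) -
  sin alpha * q 0 (inord (l * (2 * N + 2) + m)).

Lemma block_divmod {N} l {m : nat} : (m < 2 * N + 2)%N ->
  ((l * (2 * N + 2) + m) %/ (2 * N + 2) = l)%N /\
  ((l * (2 * N + 2) + m) %% (2 * N + 2) = m)%N.
Proof.
move=> mD; have D0 : (0 < 2 * N + 2)%N by apply: leq_ltn_trans mD.
by rewrite divnMDl// divn_small// addn0 modnMDl modn_small.
Qed.

Lemma block_lt {L N l m : nat} : (l < L)%N -> (m < 2 * N + 2)%N ->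
  (l * (2 * N + 2) + m < L * (2 * N + 2))%N.
Proof.
move=> lL mD; apply: (@leq_trans (l.+1 * (2 * N + 2))%N); last by rewrite leq_mul2r lL orbT.
by rewrite mulSn addnC ltn_add2r.
Qed.

Lemma frameE {R : realType} {L N : nat} (alpha : R) (U V : nat -> nat -> R) t {l m} :
  (l < L)%N -> (m < N.+1)%N ->
  frame L N alpha U V t 0 (inord (l * (2 * N + 2) + m)) =
    cos alpha * U l m - sin alpha * V l m /\
  frame L N alpha U V t 0 (inord (l * (2 * N + 2) + (m + N.+1))) =
    sin alpha * U l m + cos alpha * V l m.
Proof.
move=> lL mN; have mD : (m < 2 * N + 2)%N by lia.
have mD' : (m + N.+1 < 2 * N + 2)%N by lia.
have bl := block_lt lL mD; have bl' := block_lt lL mD'.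
rewrite !mxE !inordK ?(ltnW bl) ?(ltnW bl') ?ltnS ?bl ?bl' //=; try exact: ltnW.
have [-> ->] := block_divmod l mD; have [-> ->] := block_divmod l mD'.
by rewrite mN addnK (_ : (m + N.+1 < N.+1)%N = false)//; lia.
Qed.

Lemma frame_last {R : realType} {L N : nat} (alpha : R) (U V : nat -> nat -> R) t :
  frame L N alpha U V t 0 ord_max = t.
Proof. by rewrite mxE ltnn. Qed.

Lemma frame_inj {R : realType} {L N : nat} {alpha : R} {U V U' V' : nat -> nat -> R} {t t'} :
  frame L N alpha U V t = frame L N alpha U' V' t' ->
  t = t' /\ forall l m, (l < L)%N -> (m < N.+1)%N -> U l m = U' l m /\ V l m = V' l m.
Proof.
move=> E; split=> [|l m lL mN].
  by have := congr1 (fun q : 'rV_(dimH L N) => q 0 ord_max) E; rewrite !frame_last.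
have [e1 e2] := frameE alpha U V t lL mN.
have [] := frameE alpha U' V' t' lL mN; rewrite -E e1 e2.
have := cos2Dsin2 alpha; move: (cos alpha) (sin alpha) => c s cs f1 f2.
have inv a b : a = c * (c * a - s * b) + s * (s * a + c * b) /\
               b = c * (s * a + c * b) - s * (c * a - s * b).
  by split; rewrite -[LHS]mul1r -cs; ring.
have [eU eV] := inv (U l m) (V l m); have [eU' eV'] := inv (U' l m) (V' l m).
by split; [rewrite eU f1 f2 -eU' | rewrite eV f1 f2 -eV'].
Qed.

Lemma eq_frame {R : realType} {L N : nat} (alpha : R) (U V U' V' : nat -> nat -> R) t t' :
  (forall l m, (l < L)%N -> (m < N.+1)%N -> U l m = U' l m /\ V l m = V' l m) ->
  t = t' -> frame L N alpha U V t = frame L N alpha U' V' t'.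
Proof.
move=> E <-; apply/rowP => k; rewrite !mxE; case: ifP => // kL /=.
have lL : (k %/ (2 * N + 2) < L)%N by rewrite ltn_divLR// addn2.
have mD : (k %% (2 * N + 2) < 2 * N + 2)%N by rewrite ltn_mod addn2.
case: ifP => mN /=; first by have [-> ->] := E _ _ lL mN.
have mN' : (k %% (2 * N + 2) - N.+1 < N.+1)%N by lia.
by have [-> ->] := E _ _ lL mN'.
Qed.

(** This allows ambient maps to be defined by formulas in frame coordinates, and the mean curvature
    vector to be written in the frame of the base point. *)
Lemma frame_coord {R : realType} {L N : nat} (alpha : R) (q : 'rV[R]_(dimH L N)) :
  q = frame L N alpha (frame_re alpha q) (frame_im alpha q) (q 0 ord_max).
Proof.
apply/rowP => k; rewrite !mxE; case: ifP => kL /=; last first.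
  by congr (q _ _); apply/val_inj => /=; have := ltn_ord k; lia.
have cs := cos2Dsin2 alpha.
have kE : k = inord (k %/ (2 * N + 2) * (2 * N + 2) + k %% (2 * N + 2)).
  by apply/val_inj; rewrite -divn_eq inord_val.
rewrite /frame_re /frame_im.
case: ifP => mN; rewrite ?subnK -?kE; try lia.
- by rewrite -[LHS]mul1r -cs; ring.
- by rewrite -[LHS]mul1r -cs; ring.
Qed.

Lemma frame_lin {R : realType} {L N : nat} (alpha a : R) (U V U' V' : nat -> nat -> R) t t' :
  a *: frame L N alpha U V t + frame L N alpha U' V' t' =
  frame L N alpha (fun l m => a * U l m + U' l m) (fun l m => a * V l m + V' l m)
    (a * t + t').
Proof.
by apply/rowP => k; rewrite !mxE; case: ifP => // _ /=; case: ifP => _; ring.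
Qed.

Lemma frame_rotate {R : realType} {L N : nat} (alpha beta : R) (U V : nat -> nat -> R) t :
  frame L N (alpha + beta) U V t =
  frame L N alpha (fun l m => cos beta * U l m - sin beta * V l m)
    (fun l m => sin beta * U l m + cos beta * V l m) t.
Proof.
apply/rowP => k; rewrite !mxE; case: ifP => // _ /=.
by rewrite cosD sinD; case: ifP => _; ring.
Qed.

Lemma dot_frame {R : realType} {L N : nat} (alpha : R) (U V U' V' : nat -> nat -> R) t t' :
  dot (frame L N alpha U V t) (frame L N alpha U' V' t') =
  \sum_(l < L) \sum_(m < N.+1) (U l m * U' l m + V l m * V' l m) + t * t'.
Proof.
pose F (k : nat) : R := frame L N alpha U V t 0 (inord k) * frame L N alpha U' V' t' 0 (inord k).
rewrite dotE (eq_bigr (fun k : 'I__ => F k)); last by move=> k _; rewrite /F !inord_val.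
rewrite big_ord_recr /= {2}/F (_ : inord (L * _) = ord_max); last first.
  by apply/val_inj; rewrite /= inordK.
rewrite !frame_last; congr (_ + _).
(* The sum is cut into blocks of length [2 * N + 2], and each block into its real and imaginary
   halves. *)
rewrite -(big_mkord xpredT F) big_nat_mul big_mkord; apply: eq_bigr => l _.
rewrite -[(l * _)%N]add0n mulSn big_addn addnK.
have -> : (2 * N + 2 = N.+1 + N.+1)%N by lia.
rewrite big_mkord big_split_ord /= -big_split /=; apply: eq_bigr => m _.
have [e1 e2] := frameE alpha U V t (ltn_ord l) (ltn_ord m).
have [e1' e2'] := frameE alpha U' V' t' (ltn_ord l) (ltn_ord m).
have -> : (N.+1 + N.+1 = 2 * N + 2)%N by lia.
rewrite /F -addnA [(m + _)%N]addnC e1 e1' [(N.+1 + _)%N]addnC.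
rewrite -addnA e2 e2'.
have cs := cos2Dsin2 alpha.
by rewrite -[RHS]mul1r -cs; ring.
Qed.

Lemma Hpoint_frame {R : realType} {L N : nat} (lam lam0 Th : R) (r X Y : nat -> R) :
  Hpoint L N lam lam0 Th r X Y =
  frame L N (lam * Th) (fun l m => r l * X m) (fun l m => r l * Y m) (lam0 * Th).
Proof.
by apply/rowP => k; rewrite !mxE; case: ifP => // _ /=; case: ifP => _; ring.
Qed.

(** * Orthogonal maps in frame coordinates, and reflections *)

Lemma linear_isometry_mx {R : realType} {n : nat} (F : 'rV[R]_n -> 'rV[R]_n) :
  linear F -> (forall u v, dot (F u) (F v) = dot u v) ->
  exists2 S : 'M[R]_n, S *m S^T = 1%:M & forall u, F u = u *m S.
Proof.
move=> linF isoF; pose FM := GRing.isLinear.Build _ _ _ _ F linF.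
pose FL : {linear 'rV[R]_n -> 'rV[R]_n} := HB.pack F FM.
have FS u : F u = u *m lin1_mx FL by rewrite mul_rV_lin1.
exists (lin1_mx FL) => //; apply/matrixP => i j.
have := isoF (delta_mx 0 i) (delta_mx 0 j).
rewrite !FS /dot trmx_mul !trmx_delta mulmxA -(mulmxA _ _ (_^T)) -!colE -rowE.
by rewrite mxE [X in X = _]mxE => ->; rewrite !mxE eqxx eq_sym.
Qed.

(** A frame does not see values outside this range, so its coordinate functions can be recovered
    only up to this relation. *)
Definition agree {R : realType} (L N : nat) (U U' : nat -> nat -> R) :=
  forall l m, (l < L)%N -> (m < N.+1)%N -> U l m = U' l m.

(** The first hypothesis makes [T1] and [T2] well defined on vectors; linearity and preservation of
    the dot product then give an orthogonal matrix. The sign [e] acts on the last coordinate. *)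
Lemma frame_isometry {R : realType} {L N : nat} (alpha e : R)
    (T1 T2 : (nat -> nat -> R) -> (nat -> nat -> R) -> nat -> nat -> R) :
  (forall U V U' V', agree L N U U' -> agree L N V V' ->
     agree L N (T1 U V) (T1 U' V') /\ agree L N (T2 U V) (T2 U' V')) ->
  (forall a U V U' V' l m,
     T1 (fun l m => a * U l m + U' l m) (fun l m => a * V l m + V' l m) l m =
       a * T1 U V l m + T1 U' V' l m /\
     T2 (fun l m => a * U l m + U' l m) (fun l m => a * V l m + V' l m) l m =
       a * T2 U V l m + T2 U' V' l m) ->
  (forall U V U' V',
     \sum_(l < L) \sum_(m < N.+1) (T1 U V l m * T1 U' V' l m + T2 U V l m * T2 U' V' l m) =
     \sum_(l < L) \sum_(m < N.+1) (U l m * U' l m + V l m * V' l m)) ->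
  e * e = 1 ->
  exists2 S : 'M[R]_(dimH L N), S *m S^T = 1%:M &
    forall U V t, frame L N alpha U V t *m S = frame L N alpha (T1 U V) (T2 U V) (e * t).
Proof.
move=> Tagree Tlin Tiso ee.
pose F (q : 'rV[R]_(dimH L N)) := frame L N alpha (T1 (frame_re alpha q) (frame_im alpha q))
  (T2 (frame_re alpha q) (frame_im alpha q)) (e * q 0 ord_max).
have FE U V t : F (frame L N alpha U V t) = frame L N alpha (T1 U V) (T2 U V) (e * t).
  have [_ E] := frame_inj (frame_coord alpha (frame L N alpha U V t)).
  apply: eq_frame; last by rewrite frame_last.
  move=> l m lL mN; set U' := frame_re _ _; set V' := frame_im _ _.
  have UU : agree L N U' U by move=> i j iL jN; have [-> _] := E i j iL jN.
  have VV : agree L N V' V by move=> i j iL jN; have [_ ->] := E i j iL jN.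
  by have [-> // -> //] := Tagree _ _ _ _ UU VV.
have [S SS FS] : exists2 S : 'M[R]_(dimH L N), S *m S^T = 1%:M & forall u, F u = u *m S.
  apply: linear_isometry_mx => [a u v|u v].
    rewrite {1}(frame_coord alpha u) {1}(frame_coord alpha v) frame_lin FE /F frame_lin.
    by apply: eq_frame => [l m _ _|]; [exact: Tlin | ring].
  rewrite [in RHS](frame_coord alpha u) [in RHS](frame_coord alpha v).
  by rewrite /F !dot_frame Tiso mulrACA ee mul1r.
by exists S => // U V t; rewrite -FS FE.
Qed.

(** [2 proj_d x - x]; for [d = 0] division by zero makes it [- x], which is the
    symmetry needed at the singular points. *)
Definition line_reflection {R : realType} (n : nat) (d x : nat -> R) (l : nat) : R :=
  2 * (\sum_(i < n) d i * x i) / (\sum_(i < n) d i * d i) * d l - x l.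

Lemma sum_sqr_eq0 {R : realType} {n : nat} {d : nat -> R} :
  \sum_(i < n) d i * d i = 0 -> forall i, (i < n)%N -> d i = 0.
Proof.
move=> /psumr_eq0P d0 i iN; apply/eqP.
by rewrite -sqrf_eq0 expr2 (d0 _ (Ordinal iN)) // => j _; rewrite -expr2 sqr_ge0.
Qed.

Lemma line_reflection_isometry {R : realType} (n : nat) (d x y : nat -> R) :
  \sum_(l < n) line_reflection n d x l * line_reflection n d y l = \sum_(l < n) x l * y l.
Proof.
have expand a b : \sum_(l < n) (a * d l - x l) * (b * d l - y l) =
    a * b * (\sum_(i < n) d i * d i) - a * (\sum_(i < n) d i * y i) -
    b * (\sum_(i < n) d i * x i) + \sum_(l < n) x l * y l.
  by rewrite !mulr_sumr -!sumrB -big_split /=; apply: eq_bigr => i _; ring.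
rewrite expand; move: (\sum_(i < n) d i * d i) (\sum_(i < n) d i * x i)
  (\sum_(i < n) d i * y i) => D p q.
(* For [D = 0] both coefficients of [d] vanish, leaving the product of [- x] and [- y]. *)
have [->|D0] := eqVneq D 0; first by rewrite invr0 !(mulr0, mul0r) !subr0 add0r.
by field.
Qed.

Lemma line_reflectionD {R : realType} (n : nat) (d x y : nat -> R) a l :
  line_reflection n d (fun i => a * x i + y i) l =
  a * line_reflection n d x l + line_reflection n d y l.
Proof.
rewrite /line_reflection.
have -> : \sum_(i < n) d i * (a * x i + y i) =
    a * (\sum_(i < n) d i * x i) + \sum_(i < n) d i * y i.
  by rewrite mulr_sumr -big_split; apply: eq_bigr => i _ /=; ring.
ring.
Qed.

Lemma eq_line_reflection {R : realType} (n : nat) (d x y : nat -> R) l :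
  (forall i, (i < n)%N -> x i = y i) -> (l < n)%N ->
  line_reflection n d x l = line_reflection n d y l.
Proof.
by move=> xy ln; rewrite /line_reflection xy//; congr (2 * _ / _ * _ - _);
  apply: eq_bigr => i _; rewrite xy.
Qed.

Lemma line_reflectionZ {R : realType} (n : nat) (d x : nat -> R) a l :
  line_reflection n d (fun i => a * x i) l = a * line_reflection n d x l.
Proof.
rewrite /line_reflection (eq_bigr (fun i : 'I_n => a * (d i * x i))).
  by rewrite -mulr_sumr; ring.
by move=> i _; ring.
Qed.

(** The negated map is the reflection in the hyperplane orthogonal to [X - Y], which exchanges
    vectors of equal norm. If [X = Y] it is the identity, and the claim still holds. *)
Lemma line_reflection_swap {R : realType} {n : nat} {X Y : nat -> R} :
  \sum_(i < n) X i ^+ 2 = 1 -> \sum_(i < n) Y i ^+ 2 = 1 ->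
  forall m, (m < n)%N ->
  - line_reflection n (fun i => X i - Y i) X m = Y m /\
  - line_reflection n (fun i => X i - Y i) Y m = X m.
Proof.
move=> X1 Y1 m mn; rewrite /line_reflection.
set D := \sum_(i < n) (X i - Y i) * (X i - Y i).
pose p := \sum_(i < n) X i * Y i.
have DE : D = 2 - 2 * p.
  have -> : 2 - 2 * p = \sum_(i < n) X i ^+ 2 + \sum_(i < n) Y i ^+ 2 - 2 * p.
    by rewrite X1 Y1; ring.
  rewrite -big_split /= /p mulr_sumr -sumrB.
  by apply: eq_bigr => i _; ring.
have -> : \sum_(i < n) (X i - Y i) * X i = D / 2.
  rewrite DE (_ : _ / 2 = 1 - p); last by field.
  by rewrite -X1 /p -sumrB; apply: eq_bigr => i _; ring.
have -> : \sum_(i < n) (X i - Y i) * Y i = - D / 2.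
  rewrite DE (_ : _ / 2 = p - 1); last by field.
  by rewrite -Y1 /p -sumrB; apply: eq_bigr => i _; ring.
have [D0|D0] := eqVneq D 0; last by split; field.
have /eqP := @sum_sqr_eq0 _ _ (fun i => X i - Y i) D0 m mn; rewrite subr_eq0 => /eqP XY.
by rewrite XY; split; ring.
Qed.

Lemma is_derive_scalel {R : realType} {V : normedModType R} {k : R -> R} {dk x : R} (v : V) :
  is_derive x (1 : R) k dk -> is_derive x (1 : R) (fun s => k s *: v) (dk *: v).
Proof.
case=> /cvg_ex [l kl] <-; have -> : 'D_1 k x = l by exact: cvg_lim kl.
have E : (fun t : R => t^-1 *: (((fun s => k s *: v) \o shift x) (t *: (1 : R)) - k x *: v)) =
    (fun t => (t^-1 *: ((k \o shift x) (t *: (1 : R)) - k x)) *: v).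
  by apply/funext => t; rewrite /= -scalerBl scalerA.
have L : t^-1 *: (((fun s => k s *: v) \o shift x) (t *: (1 : R)) - k x *: v)
    @[t --> (0:R)^'] --> l *: v.
  by rewrite E; apply: cvgZ; [exact: kl | exact: cvg_cst].
by apply: DeriveDef; [apply/cvg_ex; eexists; exact: L | exact: cvg_lim L].
Qed.

(** The test vector is the normalized component of [u] orthogonal to [X]. Only unit [d] are tested
    because then [cos s X + sin s d] stays on the sphere. *)
Lemma parallel_of_orthogonal {R : realType} {n : nat} {X u : nat -> R} :
  \sum_(i < n) X i ^+ 2 = 1 ->
  (forall d : nat -> R, \sum_(i < n) d i ^+ 2 = 1 -> \sum_(i < n) X i * d i = 0 ->
     \sum_(i < n) u i * d i = 0) ->
  forall i, (i < n)%N -> u i = (\sum_(i < n) u i * X i) * X i.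
Proof.
move=> X1 u0 i iN; set a := \sum_(i < n) u i * X i.
pose w i := u i - a * X i; pose D := \sum_(i < n) w i * w i.
have Xw : \sum_(i < n) X i * w i = 0.
  have -> : \sum_(i < n) X i * w i = a - a * \sum_(i < n) X i ^+ 2; last first.
    by rewrite X1; ring.
  by rewrite {1}/a mulr_sumr -sumrB; apply: eq_bigr => j _; rewrite /w; ring.
suff D0 : D = 0 by have /eqP := sum_sqr_eq0 D0 i iN; rewrite subr_eq0 => /eqP.
apply/eqP/negPn/negP => D0.
have Dge0 : 0 <= D by apply: sumr_ge0 => j _; rewrite -expr2 sqr_ge0.
have s0 : Num.sqrt D != 0 by rewrite sqrtr_eq0 -ltNge lt_neqAle eq_sym D0.
have uw : \sum_(j < n) u j * (w j / Num.sqrt D) = 0.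
  apply: (u0 (fun j => w j / Num.sqrt D)).
    rewrite (eq_bigr (fun j : 'I_n => w j * w j / D)) => [|j _].
      by rewrite -mulr_suml divff.
    by rewrite expr_div_n sqr_sqrtr// expr2.
  rewrite (eq_bigr (fun j : 'I_n => X j * w j / Num.sqrt D)) => [|j _]; last by ring.
  by rewrite -mulr_suml Xw mul0r.
have uw0 : \sum_(j < n) u j * w j = 0.
  have -> : \sum_(j < n) u j * w j =
      (\sum_(j < n) u j * (w j / Num.sqrt D)) * Num.sqrt D.
    by rewrite mulr_suml; apply: eq_bigr => j _; field.
  by rewrite uw mul0r.
have DE : D = \sum_(j < n) u j * w j - a * \sum_(j < n) X j * w j.
  by rewrite mulr_sumr -sumrB; apply: eq_bigr => j _; rewrite /w; ring.
by rewrite DE uw0 Xw mulr0 subr0 eqxx in D0.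
Qed.

Lemma line_reflection_self {R : realType} {n : nat} {d : nat -> R} l :
  (l < n)%N -> line_reflection n d d l = d l.
Proof.
move=> ln; rewrite /line_reflection.
have [D0|D0] := eqVneq (\sum_(i < n) d i * d i) 0.
  by rewrite (sum_sqr_eq0 D0 l ln) mulr0 subr0.
by field.
Qed.

Lemma frameD {R : realType} {L N : nat} (alpha : R) (U V U' V' : nat -> nat -> R) t t' :
  frame L N alpha U V t + frame L N alpha U' V' t' =
  frame L N alpha (fun l m => U l m + U' l m) (fun l m => V l m + V' l m) (t + t').
Proof.
rewrite -[X in X + _]scale1r frame_lin.
by apply: eq_frame => [l m _ _|]; rewrite !mul1r.
Qed.

(** All points of the set are written in one frame, that of a base point; the remaining rotation by
    [beta] moves into the coordinates. *)
Lemma HpointE {R : realType} {L N : nat} (lam lam0 alpha Th : R) (r X Y : nat -> R) :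
  let beta := lam * Th - alpha in
  Hpoint L N lam lam0 Th r X Y =
  frame L N alpha (fun l m => r l * (cos beta * X m - sin beta * Y m))
    (fun l m => r l * (sin beta * X m + cos beta * Y m)) (lam0 * Th).
Proof.
rewrite /= Hpoint_frame -{1}[lam * Th](subrKC alpha) frame_rotate.
by apply: eq_frame => // l m _ _; split; ring.
Qed.

(** The reflection acts on the block index only, so exchanging the two sums reduces the isometry
    property to the one in [R^L]. *)
Lemma ray_reflection {R : realType} (L N : nat) (alpha : R) (r : nat -> R) :
  exists2 S : 'M[R]_(dimH L N), S *m S^T = 1%:M &
    forall U V t, frame L N alpha U V t *m S =
      frame L N alpha (fun l m => line_reflection L r (fun i => U i m) l)
        (fun l m => line_reflection L r (fun i => V i m) l) t.
Proof.
have [||||S SS SE] := @frame_isometry R L N alpha 1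
  (fun U V l m => line_reflection L r (fun i => U i m) l)
  (fun U V l m => line_reflection L r (fun i => V i m) l).
- move=> U V U' V' UU VV; split => l m lL mN; apply: eq_line_reflection => // i iL.
    exact: UU.
  exact: VV.
- by move=> a U V U' V' l m /=; rewrite !line_reflectionD.
- move=> U V U' V'; rewrite exchange_big [RHS]exchange_big; apply: eq_bigr => m _ /=.
  rewrite big_split [RHS]big_split /=.
  by rewrite (line_reflection_isometry L r (fun i => U i m) (fun i => U' i m))
    (line_reflection_isometry L r (fun i => V i m) (fun i => V' i m)).
- by rewrite mulr1.
by exists S => // U V t; rewrite SE mul1r.
Qed.

(** This is [Z |-> i * conj Z] followed by the reflection in the hyperplane
    orthogonal to [d]. *)
Lemma conj_reflection {R : realType} (L N : nat) (alpha : R) (d : nat -> R) :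
  exists2 S : 'M[R]_(dimH L N), S *m S^T = 1%:M &
    forall U V t, frame L N alpha U V t *m S =
      frame L N alpha (fun l m => - line_reflection N.+1 d (V l) m)
        (fun l m => - line_reflection N.+1 d (U l) m) (- t).
Proof.
have [||||S SS SE] := @frame_isometry R L N alpha (-1)
  (fun U V l m => - line_reflection N.+1 d (V l) m)
  (fun U V l m => - line_reflection N.+1 d (U l) m).
- move=> U V U' V' UU VV; split => l m lL mN; congr (- _);
    apply: eq_line_reflection => // i iL.
    exact: VV.
  exact: UU.
- by move=> a U V U' V' l m /=; rewrite !line_reflectionD; split; ring.
- move=> U V U' V'; apply: eq_bigr => l _ /=.
  under eq_bigr => m _ do rewrite !mulrNN addrC.
  rewrite big_split [RHS]big_split /=.
  by rewrite (line_reflection_isometry N.+1 d (U l)) (line_reflection_isometry N.+1 d (V l)).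
- by rewrite mulrNN mulr1.
by exists S => // U V t; rewrite SE mulN1r.
Qed.

(** Only the radii of a point change. The summand [0] is the translation part expected by
    [mean_curvature_isometry]. *)
Lemma Hset_ray_reflection {R : realType} {L N : nat} {lam lam0 alpha : R} {r : nat -> R}
    {S : 'M[R]_(dimH L N)} :
  (forall U V t, frame L N alpha U V t *m S =
      frame L N alpha (fun l m => line_reflection L r (fun i => U i m) l)
        (fun l m => line_reflection L r (fun i => V i m) l) t) ->
  forall q, Hset L N lam lam0 q -> Hset L N lam lam0 (q *m S + 0).
Proof.
move=> SE q [Th [r' [X [Y [X1 [Y1 ->]]]]]].
exists Th, (line_reflection L r r'), X, Y; split=> //; split=> //.
rewrite addr0 !(HpointE _ _ alpha) SE; apply: eq_frame => // l m _ _.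
have E c : (fun i => r' i * c) = (fun i => c * r' i).
  by apply/funext => i; rewrite mulrC.
by rewrite !E !line_reflectionZ ![_ * line_reflection _ _ _ _]mulrC.
Qed.

Lemma Hset_conj_reflection {R : realType} {L N : nat} {lam lam0 Th0 : R} {d : nat -> R}
    {S : 'M[R]_(dimH L N)} :
  (forall U V t, frame L N (lam * Th0) U V t *m S =
      frame L N (lam * Th0) (fun l m => - line_reflection N.+1 d (V l) m)
        (fun l m => - line_reflection N.+1 d (U l) m) (- t)) ->
  forall q, Hset L N lam lam0 q -> Hset L N lam lam0
    (q *m S + frame L N (lam * Th0) (fun _ _ => 0) (fun _ _ => 0) (2 * (lam0 * Th0))).
Proof.
move=> SE q [Th [r [X [Y [X1 [Y1 ->]]]]]].
have unit_refl Z : unit_vec N Z -> unit_vec N (fun m => - line_reflection N.+1 d Z m).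
  move=> Z1; rewrite /unit_vec -[RHS]Z1.
  under eq_bigr => m _ do rewrite sqrrN expr2.
  by rewrite line_reflection_isometry; apply: eq_bigr => m _; rewrite expr2.
(* Conjugation reverses the rotation relative to the base frame, so [Th] is reflected about [Th0];
   multiplication by [i] exchanges the roles of [X] and [Y]. The translation makes the last
   coordinate follow the same reflection. *)
exists (2 * Th0 - Th), r, (fun m => - line_reflection N.+1 d Y m),
  (fun m => - line_reflection N.+1 d X m).
split; first exact: unit_refl.
split; first exact: unit_refl.
rewrite !(HpointE _ _ (lam * Th0)) SE frameD.
have -> : lam * (2 * Th0 - Th) - lam * Th0 = - (lam * Th - lam * Th0) by ring.
rewrite cosN sinN; move: (cos _) (sin _) => c s.
apply: eq_frame => [l m _ _|]; last by ring.
have E a b l' : line_reflection N.+1 d (fun m => r l' * (a * X m + b * Y m)) m =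
   r l' * (a * line_reflection N.+1 d X m + b * line_reflection N.+1 d Y m).
  rewrite line_reflectionZ line_reflectionD line_reflectionZ.
  by [].
have E' : (fun m => r l * (c * X m - s * Y m)) = (fun m => r l * (c * X m + (- s) * Y m)).
  by apply/funext => j; rewrite mulNr.
by rewrite E' !E; split; ring.
Qed.

(** * Invariance under the screw motion, and minimality *)

Lemma screw_Hpoint {R : realType} {L N : nat} (lam lam0 Th th : R) (r X Y : nat -> R) :
  screw L N (fun _ => lam) lam0 th (Hpoint L N lam lam0 Th r X Y) =
  Hpoint L N lam lam0 (Th + th) r X Y.
Proof.
rewrite !Hpoint_frame; set U := fun l m => r l * X m; set V := fun l m => r l * Y m.
apply/rowP => k; rewrite [LHS]mxE [RHS]mxE; case: ifP => kL /=; last first.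
  by rewrite mxE kL -mulrDr.
have lL : (k %/ (2 * N + 2) < L)%N by rewrite ltn_divLR// addn2.
have mD : (k %% (2 * N + 2) < 2 * N + 2)%N by rewrite ltn_mod addn2.
have kE := divn_eq k (2 * N + 2).
move: (k %/ _)%N (k %% _)%N lL mD kE => l m lL mD kE.
rewrite mulrDr cosD sinD; case: ifP => mN.
  have [e1 e2] := frameE (lam * Th) U V (lam0 * Th) lL mN.
  rewrite -(inord_val k) inord_val kE -addnA e2 -kE inord_val in e1 *.
  by rewrite e1; ring.
have mN' : (m - N.+1 < N.+1)%N by lia.
have [] := frameE (lam * Th) U V (lam0 * Th) lL mN'.
rewrite (_ : l * (2 * N + 2) + (m - N.+1) = k - N.+1)%N; last lia.
rewrite (_ : l * (2 * N + 2) + (m - N.+1 + N.+1) = k)%N; last lia.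
by rewrite inord_val => -> ->; ring.
Qed.

Lemma Hset_minimal {R : realType} {L N : nat} (lam lam0 : R) :
  minimal_set _ (Hset L N lam lam0).
Proof.
move=> k W V phi oW oV ephi im x Wx.
have [Th [r [X [Y [X1 [Y1 px]]]]]] : Hset L N lam lam0 (phi x).
  by have : (phi @` W) (phi x) by [exists x]; rewrite im => -[].
have HF r' X' Y' : frame L N (lam * Th) (fun l m => r' l * X' m) (fun l m => r' l * Y' m)
    (lam0 * Th) = Hpoint L N lam lam0 Th r' X' Y' by rewrite Hpoint_frame.
rewrite -HF in px; move: HF; set alpha := lam * Th in px * => HF.
have fixed := mean_curvature_isometry oW oV ephi im Wx.
have ortho := mean_curvature_dot_velocity oW oV ephi im Wx.
set H := mean_curvature phi x in fixed ortho *.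
have HE := frame_coord alpha H.
move: (frame_re alpha H) (frame_im alpha H) (H 0 ord_max) HE => HU HV ht HE.
pose D := \sum_(i < L) r i * r i.
(* If the blocks of [H] are [r l] times a common vector, pairing with [r] recovers it. For [D = 0]
   the quotient is [0]. *)
pose u m := (\sum_(i < L) r i * HU i m) / D.
pose v m := (\sum_(i < L) r i * HV i m) / D.
have Huv l m : (l < L)%N -> (m < N.+1)%N -> HU l m = r l * u m /\ HV l m = r l * v m.
  have [S SS SE] := ray_reflection L N alpha r.
  have := fixed S 0 SS (Hset_ray_reflection SE); rewrite addr0 px SE.
  have E Z : agree L N (fun l m => line_reflection L r (fun i => r i * Z m) l)
      (fun l m => r l * Z m).
    move=> i j iL jN; rewrite (_ : (fun i => _) = (fun i => Z j * r i)).
      by rewrite line_reflectionZ line_reflection_self// mulrC.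
    by apply/funext => i'; rewrite mulrC.
  have -> : frame L N alpha
    (fun l m => line_reflection L r (fun i => r i * X m) l)
    (fun l m => line_reflection L r (fun i => r i * Y m) l) (lam0 * Th) =
    frame L N alpha (fun l m => r l * X m) (fun l m => r l * Y m) (lam0 * Th).
    by apply: eq_frame => // i j iL jN; rewrite E// E.
  rewrite HE SE => /(_ erefl) /frame_inj [_ fx] lL mN.
  have [fU fV] := fx l m lL mN.
  move: fU fV; rewrite /line_reflection -/D => fU fV.
  split; [have : HU l m + HU l m = 2 * (r l * u m) by rewrite -{1}fU /u; ring
         | have : HV l m + HV l m = 2 * (r l * v m) by rewrite -{1}fV /v; ring]; lra.
have [ht0 Hswap] : ht = 0 /\ forall l m, (l < L)%N -> (m < N.+1)%N ->
    HU l m = - line_reflection N.+1 (fun i => X i - Y i) (HV l) m /\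
    HV l m = - line_reflection N.+1 (fun i => X i - Y i) (HU l) m.
  have [S SS SE] := conj_reflection L N alpha (fun i => X i - Y i).
  have := fixed S _ SS (Hset_conj_reflection SE).
  have -> : phi x *m S + frame L N (lam * Th) (fun _ _ => 0) (fun _ _ => 0) (2 * (lam0 * Th))
      = phi x.
    rewrite px SE frameD; apply: eq_frame => [l m lL mN|]; last by ring.
    have [XY YX] := line_reflection_swap X1 Y1 m mN.
    by rewrite !line_reflectionZ !addr0 -!mulrN XY YX.
  rewrite HE SE => /(_ erefl) /frame_inj [th fx]; split; first lra.
  by move=> l m lL mN; have [-> ->] := fx l m lL mN.
(* Velocities with the radii factored out pair with [H] through [u] and [v], up to [D], which is
   cancelled away from the singular points. *)
have dotH a b : dot H (frame L N alpha (fun l m => r l * a m) (fun l m => r l * b m) 0) =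
    D * (\sum_(m < N.+1) u m * a m + \sum_(m < N.+1) v m * b m).
  rewrite HE dot_frame mulr0 addr0 /D mulr_suml; apply: eq_bigr => l _.
  rewrite -big_split mulr_sumr; apply: eq_bigr => m _ /=.
  by have [-> ->] := Huv l m (ltn_ord l) (ltn_ord m); ring.
suff HUV0 l m : (l < L)%N -> (m < N.+1)%N -> HU l m = 0 /\ HV l m = 0.
  have -> : H = frame L N alpha (fun _ _ => 0) (fun _ _ => 0) 0.
    by rewrite HE ht0; apply: eq_frame => // i j iL jN; exact: HUV0.
  apply/rowP => i; rewrite !mxE; case: ifP => // _ /=.
  by case: ifP => _; rewrite !mulr0 ?subr0 ?addr0.
have [D0|D0] := eqVneq D 0.
  move=> lL mN; have [-> ->] := Huv l m lL mN.
  by rewrite (sum_sqr_eq0 D0 l lL) !mul0r.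
have tangent a b (g : R -> _) : g 0 = phi x -> (forall s, Hset L N lam lam0 (g s)) ->
    is_derive (0 : R) (1 : R) g
      (frame L N alpha (fun l m => r l * a m) (fun l m => r l * b m) 0) ->
    \sum_(m < N.+1) u m * a m + \sum_(m < N.+1) v m * b m = 0.
  move=> g0 gM dg; apply: (mulfI D0); rewrite mulr0 -dotH.
  by apply: ortho dg => //; exact: nearW.
have circle (Z d : nat -> R) : \sum_(m < N.+1) Z m ^+ 2 = 1 -> \sum_(m < N.+1) d m ^+ 2 = 1 ->
    \sum_(m < N.+1) Z m * d m = 0 ->
    forall s, unit_vec N (fun m => cos s * Z m + sin s * d m).
  move=> Z1 d1 Zd s; rewrite /unit_vec -(cos2Dsin2 s).
  rewrite (eq_bigr (fun m : 'I_N.+1 => cos s ^+ 2 * Z m ^+ 2 + sin s ^+ 2 * d m ^+ 2 +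
    2 * cos s * sin s * (Z m * d m))) => [|j _]; last by ring.
  by rewrite !big_split /= -!mulr_sumr Z1 d1 Zd; ring.
(* Turning [X] or [Y] along a great circle replaces its contribution [a] to the point by
   [cos s a + sin s b]. *)
have velocity (a b : 'rV[R]_(dimH L N)) :
    is_derive (0 : R) (1 : R) (fun s : R => phi x + ((cos s - 1) *: a + sin s *: b)) b.
  have dc : is_derive (0 : R) (1 : R) (fun s : R => cos s - 1) 0.
    by apply: is_derive_eq; rewrite sin0; ring.
  have ds : is_derive (0 : R) (1 : R) (sin : R -> R) 1.
    by rewrite -[X in is_derive _ _ _ X]cos0; exact: is_derive_sin.
  have := is_deriveD (is_derive_cst (phi x) (0 : R) (1 : R))
    (is_deriveD (is_derive_scalel a dc) (is_derive_scalel b ds)).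
  by rewrite scale0r scale1r !add0r.
have uX := parallel_of_orthogonal X1 (u := u).
have vY := parallel_of_orthogonal Y1 (u := v).
have {}uX : forall m, (m < N.+1)%N -> u m = (\sum_(m < N.+1) u m * X m) * X m.
  apply: uX => d d1 Xd.
  have vel := velocity (frame L N alpha (fun l m => r l * X m) (fun l m => r l * 0) 0)
    (frame L N alpha (fun l m => r l * d m) (fun l m => r l * 0) 0).
  have := fun g0 gM => tangent d (fun _ => 0) _ g0 gM vel.
  rewrite [X in _ + X = 0](big1 _ xpredT) => [|j _]; last by rewrite mulr0.
  rewrite addr0; apply.
    by rewrite cos0 sin0 subrr !scale0r !addr0.
  move=> s; exists Th, r, (fun m => cos s * X m + sin s * d m), Y.
  split; first exact: circle.
  split=> //; rewrite -HF px; apply/rowP => i; rewrite !mxE.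
  by case: ifP => _ /=; [case: ifP => _; ring | ring].
have {}vY : forall m, (m < N.+1)%N -> v m = (\sum_(m < N.+1) v m * Y m) * Y m.
  apply: vY => d d1 Yd.
  have vel := velocity (frame L N alpha (fun l m => r l * 0) (fun l m => r l * Y m) 0)
    (frame L N alpha (fun l m => r l * 0) (fun l m => r l * d m) 0).
  have := fun g0 gM => tangent (fun _ => 0) d _ g0 gM vel.
  rewrite [X in X + _ = 0](big1 _ xpredT) => [|j _]; last by rewrite mulr0.
  rewrite add0r; apply.
    by rewrite cos0 sin0 subrr !scale0r !addr0.
  move=> s; exists Th, r, X, (fun m => cos s * Y m + sin s * d m).
  split=> //; split; first exact: circle.
  rewrite -HF px; apply/rowP => i; rewrite !mxE.
  by case: ifP => _ /=; [case: ifP => _; ring | ring].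
(* The curve scales all radii by [1 + s]. *)
have pq : \sum_(m < N.+1) u m * X m + \sum_(m < N.+1) v m * Y m = 0.
  apply: (tangent X Y (fun s : R => phi x +
    s *: frame L N alpha (fun l m => r l * X m) (fun l m => r l * Y m) 0)).
  - by rewrite scale0r addr0.
  - move=> s; exists Th, (fun l => (1 + s) * r l), X, Y; do 2!split=> //.
    rewrite -HF px; apply/rowP => i; rewrite !mxE.
    by case: ifP => _ /=; [case: ifP => _; ring | ring].
  - rewrite -[X in is_derive _ _ _ X]add0r; apply: is_deriveD.
    by rewrite -[X in is_derive _ _ _ X]scale1r; apply: is_derive_scalel.
move: (\sum_(m < N.+1) u m * X m) (\sum_(m < N.+1) v m * Y m) uX vY pq => p q uX vY pq.
(* Now [u = p X] and [v = q Y] with [p + q = 0]. The swap gives [r l * p * X m = r l * q * X m], and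
   likewise for [Y]; with [q = - p] each entry equals its opposite. *)
move=> lL mN; have [swapU swapV] := Hswap l m lL mN.
have [XY YX] := line_reflection_swap X1 Y1 m mN.
have [HUm HVm] := Huv l m lL mN.
move: swapU; rewrite (@eq_line_reflection _ _ _ _ (fun i => (r l * q) * Y i)) => [|i iN|//].
  rewrite line_reflectionZ -mulrN YX HUm uX// => swapU.
  move: swapV; rewrite (@eq_line_reflection _ _ _ _ (fun i => (r l * p) * X i)) => [|i iN|//].
    rewrite line_reflectionZ -mulrN XY HVm vY// => swapV.
    have qE : q = - p by lra.
    by rewrite qE in swapU swapV *; split; lra.
  by have [-> _] := Huv l i lL iN; rewrite uX// mulrA.
by have [_ ->] := Huv l i lL iN; rewrite vY// mulrA.
Qed.

Theorem theorem3p3 (R : realType) (L N : nat) (lam lam0 : R) :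
  (1 <= L)%N ->
  minimal_set _ (Hset L N lam lam0) /\
  (forall (th : R) (p : 'rV[R]_(dimH L N)),
      Hset L N lam lam0 p -> Hset L N lam lam0 (screw L N (fun _ => lam) lam0 th p)).
Proof.
move=> _; split=> [|th p [Th [r [X [Y [X1 [Y1 ->]]]]]]]; first exact: Hset_minimal.
by exists (Th + th), r, X, Y; rewrite screw_Hpoint.
Qed.
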